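(* Let $X=\{0,1\}^{\mathbb{N}\cup\{0\}}$, let $T\colon X\to X$ be the left shift, and let $\mu$ be the $(1/2,1/2)$-Bernoulli measure on $X$. Let $(r_m)_{m\in\mathbb{N}}$ be a non-decreasing unbounded sequence of positive integers, and let $\mathcal{B}=\{B_1\supset B_2\supset\cdots\}$ with $$B_m=\{x\in X: x[0]=x[1]=\cdots=x[r_m-1]=0\},\qquad m\in\mathbb{N}.$$ If there exists $D>2$ such that $\mu(B_m)\geq \frac{D\log\log m}{m}$ for all but finitely many $m\in\mathbb{N}$, then $\mathcal{H}_{\mathrm{e.a.}}(\mathcal{B})$ has full $\mu$-measure. If, on the other hand, $$\mu(B_m)\leq \frac{2\log\log m}{m}\quad\text{for all but finitely many }m\in\mathbb{N},$$ then $\mathcal{H}_{\mathrm{e.a.}}(\mathcal{B})$ has zero $\mu$-measure.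
   Context: $\mathbb{N}=\{1,2,3,\dots\}$. Points of $X$ are sequences $x=(x[0],x[1],x[2],\dots)$, and $(Tx)[i]=x[i+1]$. Put $O_m(x)=\{Tx,T^2x,\dots,T^mx\}$. The eventually always hitting set is $$\mathcal{H}_{\mathrm{e.a.}}(\mathcal{B})=\{x\in X: O_m(x)\cap B_m\neq\varnothing\text{ for all but finitely many }m\in\mathbb{N}\}.$$ *)

(* Defs.v *)
From HB Require Import structures.
From mathcomp Require Import all_boot all_order all_algebra.
From mathcomp Require Import all_classical all_reals all_analysis.
From mathcomp Require Import measurable_realfun.
Import Order.TTheory GRing.Theory Num.Theory.
Import numFieldNormedType.Exports.

Set Implicit Arguments.
Unset Strict Implicit.
Unset Printing Implicit Defensive.

Local Open Scope classical_set_scope.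
Local Open Scope ring_scope.

(* Generators of the product sigma-algebra on [nat -> bool]: the preimages of
   measurable sets of symbols under the coordinate maps. *)
Definition coordinate_sets : set (set (nat -> bool)) :=
  \bigcup_i preimage_set_system setT (fun x : nat -> bool => x i) measurable.

(* [false] is the symbol 0 and [true] is the symbol 1. *)
Definition binseq := g_sigma_algebraType coordinate_sets.

Definition shift (x : binseq) : binseq := fun i => x i.+1.

(* The (1/2,1/2)-Bernoulli measure, through its values on the cylinders over
   initial words: they form, with the empty set, a pi-system generating the
   product sigma-algebra, so at most one [mu] qualifies;
   [fair_bernoulli_exists] shows that one does. *)
Definition fair_bernoulli (R : realType) (mu : probability binseq R) : Prop :=
  forall (n : nat) (w : nat -> bool),
    mu [set x : binseq | forall i, (i < n)%N -> x i = w i] = (2^-1 ^+ n)%:E.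

(* The orbit starts at [shift x], not at [x]. *)
Definition forward_orbit (m : nat) (x : binseq) : set binseq :=
  [set iter k shift x | k in [set k | (1 <= k <= m)%N]].

Definition eventually_always_hitting (B : nat -> set binseq) : set binseq :=
  [set x | \forall m \near \oo, forward_orbit m x `&` B m !=set0].

Definition zero_cylinder (n : nat) : set binseq :=
  [set x | forall i, (i < n)%N -> x i = false].

Lemma measurable_coordinate i (b : bool) :
  measurable [set x : binseq | x i = b].
Proof.
apply: sub_sigma_algebra; exists i => //; exists [set b] => //.
by rewrite setTI.
Qed.

Lemma measurable_cylinder n (w : nat -> bool) :
  measurable [set x : binseq | forall i, (i < n)%N -> x i = w i].
Proof.
rewrite (_ : mkset _ = \bigcap_(i in `I_n) [set x : binseq | x i = w i]).
  by apply: bigcap_measurableType => i _; exact: measurable_coordinate.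
by apply/seteqP; split => x /=.
Qed.

Lemma measurable_shift_iter k (A : set binseq) : measurable A ->
  measurable [set x : binseq | A (iter k shift x)].
Proof.
suff H : measurable_fun setT shift.
  elim: k A => [//|k IH] A mA.
  have := H measurableT A mA; rewrite setTI => mB.
  exact: IH _ mB.
apply: (@measurability _ _ _ _ setT shift coordinate_sets erefl).
move=> _ [_ [i _ [C _ <-]] <-]; rewrite !setTI.
apply: sub_sigma_algebra; exists i.+1 => //; exists C => //.
by rewrite setTI.
Qed.

Lemma measurable_eventually_always_hitting (B : nat -> set binseq) :
  (forall m, measurable (B m)) -> measurable (eventually_always_hitting B).
Proof.
move=> mB.
rewrite (_ : eventually_always_hitting B = \bigcup_N \bigcap_(m in [set m | N <= m]%N)
   \bigcup_(k in [set k | 1 <= k <= m]%N) [set x : binseq | B m (iter k shift x)]).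
  apply: bigcupT_measurable => N; apply: bigcap_measurableType => m _.
  by apply: bigcup_measurable => k _; exact: measurable_shift_iter.
apply/seteqP; split => x /=.
  move=> [N _ H]; exists N => // m /= Nm.
  by have [_ [[k km <-] Bk]] := H m Nm; exists k.
move=> [N _ H]; exists N => // m /= Nm.
have [k km Bk] := H m Nm; exists (iter k shift x); split => //.
by exists k.
Qed.

Section existence.
Variable R : realType.

Let digits (t : measurableTypeR R) : binseq :=
  fun i => odd (Num.truncn (2 ^+ i.+1 * t)).

Let measurable_truncn (c : R) (P : pred nat) :
  measurable [set t : measurableTypeR R | P (Num.truncn (c * t))].
Proof.
have mle k : measurable [set t : measurableTypeR R | (Num.truncn (c * t)%R <= k)%N].
  rewrite (_ : mkset _ = [set t | (c * t < k.+1%:R)%R]).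
    have mc : measurable_fun setT (fun t : measurableTypeR R => c * t).
      exact: mulrl_measurable.
    have := measurable_fun_ltr mc (measurable_cst (k.+1%:R : R)).
    move=> /(_ measurableT [set true] I); rewrite setTI.
    by congr measurable; apply/seteqP; split => t /=.
  by apply/seteqP; split => t /=; rewrite truncn_le_nat.
rewrite (_ : mkset _ =
    \bigcup_(k in [set k | P k]) [set t : R | Num.truncn (c * t) = k]).
  apply: bigcup_measurable => -[|k] _.
    rewrite (_ : mkset _ = [set t | (Num.truncn (c * t) <= 0)%N]) //.
    by apply/seteqP; split => t /=; [move=> -> | rewrite leqn0 => /eqP].
  rewrite (_ : mkset _ = [set t | (Num.truncn (c * t) <= k.+1)%N] `\`
                         [set t | (Num.truncn (c * t) <= k)%N]).
    exact: measurableD.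
  apply/seteqP; split => t /=.
    by move=> ->; rewrite leqnn ltnn.
  by move=> [ak /negP]; rewrite -ltnNge => kb; apply/eqP; rewrite eqn_leq ak.
apply/seteqP; split => t /=; first by move=> Pt; exists (Num.truncn (c * t)).
by move=> [k Pk ->].
Qed.

Let measurable_digits : measurable_fun setT digits.
Proof.
apply: (@measurability _ _ _ _ setT digits coordinate_sets erefl).
move=> _ [_ [i _ [C _ <-]] <-]; rewrite !setTI.
have := measurable_truncn (2 ^+ i.+1) (fun k => `[< C (odd k) >]).
by congr measurable; apply/seteqP; split => t /=; [move=> /asboolP|move=> ?; apply/asboolP].
Qed.

Let digitsP n (w : nat -> bool) : exists2 k, (k < 2 ^ n)%N &
  forall t : R, 0 <= t < 1 ->
    (forall i, (i < n)%N -> digits t i = w i) <-> Num.truncn (2 ^+ n * t) = k.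
Proof.
elim: n => [|n [k kn IH]].
  exists 0%N => // t /andP[t0 t1]; split => // _.
  by apply: truncn_def; rewrite expr0 mul1r t0.
exists (w n + k.*2)%N.
  by rewrite expnS mul2n; have := leq_double k.+1 (2 ^ n); rewrite kn doubleS; case: (w n) => // /ltnW.
move=> t t01; have /andP[t0 t1] := t01.
have half : (Num.truncn (2 ^+ n.+1 * t))./2 = Num.truncn (2 ^+ n * t).
  have h0 : 0 <= 2 ^+ n.+1 * t by rewrite mulr_ge0// exprn_ge0.
  apply/esym/truncn_def.
  have /andP[a1 a2] := truncn_itv h0; move: a1 a2.
  set K := Num.truncn _ => a1 a2.
  have e1 : (K./2.*2 <= K)%N by rewrite -{2}(odd_double_half K) leq_addl.
  have e2 : (K < K./2.+1.*2)%N.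
    by rewrite -{1}(odd_double_half K) doubleS; case: (odd K).
  have p2 : (2 : R) > 0 by [].
  rewrite -(ler_pM2l p2) -(ltr_pM2l p2) mulrA -exprS -!natrM !mul2n.
  rewrite (le_trans _ a1) ?ler_nat//= (lt_le_trans a2)//.
  by rewrite ler_nat.
split.
  move=> H; rewrite -(odd_double_half (Num.truncn _)) half.
  congr (_ + _.*2)%N; first by rewrite -(H n).
  by apply/(IH t t01) => i /ltnW; exact: H.
move=> E; have hk : Num.truncn (2 ^+ n * t) = k.
  by rewrite -half E half_bit_double.
move=> i; rewrite ltnS leq_eqVlt => /orP[/eqP ->|]; last first.
  by move=> lin; exact: (IH t t01).2 hk i lin.
by rewrite /digits E oddD odd_double addbF oddb.
Qed.

HB.instance Definition _ :=
  isMeasurableFun.Build _ _ _ _ digits measurable_digits.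

Lemma fair_bernoulli_exists :
  exists mu : probability binseq R, fair_bernoulli mu.
Proof.
pose P : probability (measurableTypeR R) R := uniform_prob (@ltr01 R).
exists (distribution P digits) => n w.
rewrite /distribution /= /pushforward /=.
have [k kn kP] := digitsP n w.
have p2 : (0 : R) < 2 ^+ n by rewrite exprn_gt0.
pose I := `[k%:R / 2 ^+ n, k.+1%:R / 2 ^+ n[ : interval R.
have Isub : [set` I] `<=` [set` `[0%R, 1%R[ ].
  move=> t /=; rewrite !in_itv/= => /andP[a b].
  rewrite (le_trans _ a) ?divr_ge0//= ?(ltW p2)// (lt_le_trans b)//.
  by rewrite ler_pdivrMr// mul1r -natrX ler_nat.
have IE t : 0 <= t < 1 ->
    (digits t \in [set x : binseq | forall i, (i < n)%N -> x i = w i])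
    = (t \in [set` I]).
  move=> t01; apply/idP/idP; rewrite !inE /=.
    move=> /(kP t t01) E; rewrite in_itv/= ler_pdivrMr// ltr_pdivlMr//.
    have /truncn_itv : 0 <= 2 ^+ n * t.
      by rewrite mulr_ge0 ?(ltW p2)//; case/andP: t01.
    by rewrite E mulrC.
  rewrite in_itv/= ler_pdivrMr// ltr_pdivlMr// => H.
  by apply/(kP t t01)/truncn_def; rewrite mulrC.
set C := digits @^-1` _.
have mC : measurable C.
  by have := measurable_digits measurableT (measurable_cylinder n w); rewrite setTI.
rewrite /uniform_prob integral_uniform_pdf.
rewrite (eq_integral (cst 1%E)); last first.
  move=> t; rewrite inE => -[_] /=; rewrite in_itv/= /uniform_pdf => ->.
  by rewrite subr0 invr1.
rewrite integral_cst//=; last exact: measurableI.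
rewrite mul1e.
have lI : lebesgue_measure ([set` I] : set R) = (2^-1 ^+ n)%:E.
  rewrite lebesgue_measure_itv/= lte_fin ltr_pM2r ?invr_gt0// ltr_nat ltnSn.
  by rewrite -EFinD -mulrBl -natrB// subSnn mul1r exprVn.
rewrite -lI; apply/eqP; rewrite eq_le; apply/andP; split.
  have -> : lebesgue_measure [set` I] =
      (lebesgue_measure [set` I] + lebesgue_measure [set 1%R : R])%E.
    by rewrite lebesgue_measure_set1 adde0.
  have le1 : C `&` `[0%R, 1%R]%classic `<=` [set` I] `|` [set 1%R].
    move=> t [Ct] /=; rewrite in_itv/= => /andP[t0].
    rewrite le_eqVlt => /predU1P[->|t1]; [by right|left].
    have := IE t; rewrite t0 t1 => /(_ isT) E.
    have : t \in [set` I] by rewrite -E inE.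
    by rewrite inE.
  apply: (@le_trans _ _ (lebesgue_measure ([set` I] `|` [set 1%R : R]))).
    apply: le_measure => //; rewrite inE.
      exact: measurableI.
    exact: measurableU.
  exact: measureU2.
apply: le_measure; rewrite ?inE//; first exact: measurableI.
move=> t It; have := Isub t It; rewrite /= in_itv/= => t01; split.
  have : t \in [set` I] by rewrite inE.
  by rewrite -(IE t t01) inE.
by move: t01 => /andP[t0 /ltW t1]; rewrite /= in_itv/= t0 t1.
Qed.

End existence.

(* Main.v *)
Require Import Defs.
From mathcomp Require Import all_boot all_order all_algebra.
From mathcomp Require Import all_classical all_reals all_analysis.
From mathcomp Require Import ring lra zify.
Import Order.TTheory GRing.Theory Num.Theory.
Import numFieldNormedType.Exports.

(* Let p(n) be the probability that n fair bits contain no run of s zeros.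
   Conditioning on the first bit gives p(s+k+1) = p(s+k) - 2^-(s+1) p(k), so that
   p(s+k) is close to exp(-k 2^-(s+1)) in both directions.

   Full measure: missing B_m forces a miss at the first time a_s with
   r(a_s) >= s, where s = r_m.  As mu(B_m) >= D ln ln m / m at m = a_s, this has
   probability at most (ln a_s)^(-D/2) = O(s^(-D/2)), and Borel-Cantelli applies.

   Zero measure: the r_m being integers, the upper bound on mu(B_m) forces
   r_m >= s already at m = 2^s u with u just above ln ln m, where a miss still
   has probability at least c s^(-3/4).  For scales s_1 < s_2 < ..., a run of s_j
   zeros before time M_j = 2^(s_j) u + s_j either starts before M_(j-1), which is
   unlikely if the scales are well separated, or lies in the block
   [M_(j-1), M_j); these blocks are independent, and there are enough scales of
   comparable size for the probability that all of them succeed to vanish. *)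

Set Implicit Arguments.
Unset Strict Implicit.
Unset Printing Implicit Defensive.

Local Open Scope classical_set_scope.
Local Open Scope ring_scope.

(** * Events determined by finitely many fair bits *)

Section word_prob.
Variable R : realType.
Implicit Types (P Q : pred (seq bool)) (n m : nat).

(** Averaging over the first bit, rather than counting words, makes conditioning on that bit true by
    computation. *)
Fixpoint word_prob P n : R :=
  if n is k.+1 then
    (word_prob (fun w => P (false :: w)) k +
     word_prob (fun w => P (true :: w)) k) / 2
  else (P [::])%:R.

Lemma word_prob_ge0 P n : 0 <= word_prob P n.
Proof.
by elim: n P => [|n IH] P /=; [exact: ler0n | rewrite divr_ge0 ?addr_ge0].
Qed.

Lemma word_probD P Q n :
  word_prob P n = word_prob (predI P Q) n + word_prob (predI P (predC Q)) n.
Proof.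
elim: n P Q => [|n IH] P Q /=; first by case: (P _); case: (Q _); rewrite ?addr0 ?add0r.
rewrite (IH _ (fun w => Q (false :: w))) (IH (fun w => P (true :: w)) (fun w => Q (true :: w))).
by rewrite -mulrDl addrACA.
Qed.

Lemma word_prob_eq P Q n : (forall w, size w = n -> P w = Q w) ->
  word_prob P n = word_prob Q n.
Proof.
elim: n P Q => [|n IH] P Q PQ /=; first by rewrite PQ.
by congr ((_ + _) / 2); apply: IH => w sw; apply: PQ; rewrite /= sw.
Qed.

Lemma word_prob_le P Q n : (forall w, size w = n -> P w -> Q w) ->
  word_prob P n <= word_prob Q n.
Proof.
move=> PQ; rewrite (word_probD Q P) -[leLHS]addr0 lerD ?word_prob_ge0//.
rewrite le_eqVlt; apply/orP; left; apply/eqP; apply: word_prob_eq => w /PQ /=.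
by case: (P w) => [->|] //; rewrite andbF.
Qed.

Lemma word_probT n : word_prob predT n = 1.
Proof. by elim: n => [|n IH] //=; rewrite IH; lra. Qed.

Lemma word_prob_le1 P n : word_prob P n <= 1.
Proof. by rewrite -(word_probT n); exact: word_prob_le. Qed.

Lemma word_probC P n : word_prob (predC P) n = 1 - word_prob P n.
Proof.
rewrite -(word_probT n) (word_probD predT P).
by rewrite [X in X + _ - _](word_prob_eq (Q := P))// addrC addKr.
Qed.

Lemma word_probU P Q n :
  word_prob (predU P Q) n <= word_prob P n + word_prob Q n.
Proof.
rewrite (word_probD _ P) lerD//; apply: word_prob_le => w _ /=; first by case/andP.
by case: (P w); rewrite /= ?andbT.
Qed.

Lemma word_prob0 n : word_prob pred0 n = 0.
Proof. by rewrite (@word_prob_eq _ (predC predT))// word_probC word_probT subrr. Qed.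

(** Independence of disjoint blocks of bits. *)
Lemma word_prob_cat P Q n m :
  word_prob (fun w => P (take n w) && Q (drop n w)) (n + m) =
  word_prob P n * word_prob Q m.
Proof.
elim: n P => [|n IH] P /=.
  rewrite add0n; case PE: (P [::]); rewrite ?mul1r ?mul0r.
    by apply: word_prob_eq => w _; rewrite take0 drop0 PE.
  by rewrite -(word_prob0 m); apply: word_prob_eq => w _; rewrite take0 PE.
rewrite (IH (fun w => P (false :: w))) (IH (fun w => P (true :: w))).
by field.
Qed.

Lemma word_prob1 (u : seq bool) : word_prob (pred1 u) (size u) = 2^-1 ^+ size u.
Proof.
elim: u => [|b u IH] //=; rewrite exprS -IH.
have cons_eq c : word_prob (fun w => c :: w == b :: u) (size u) =
    (c == b)%:R * word_prob (pred1 u) (size u).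
  case: eqP => [->|/eqP/negbTE cb]; rewrite ?mul1r ?mul0r.
    by apply: word_prob_eq => w _; rewrite /= eqseq_cons eqxx.
  by rewrite -(word_prob0 (size u)); apply: word_prob_eq => w _; rewrite eqseq_cons cb.
rewrite (cons_eq false) (cons_eq true).
by case: (b); rewrite /= ?mul1r ?mul0r ?add0r ?addr0 mulrC.
Qed.

End word_prob.

(** * The Bernoulli measure on events of finitely many coordinates *)

Section bernoulli.
Context {R : realType} (mu : probability binseq R) (mu_bernoulli : fair_bernoulli mu).

(** Carrying the prefix [u] lets the induction on [n] split on the bit after [u], down to the
    cylinders on which [mu] is given. Measurability goes along because additivity needs it. *)
Lemma cylinder_word_prob (P : pred (seq bool)) (u : seq bool) n :
  let A := [set x : binseq | mkseq x (size u) = u /\ P (mkseq x (size u + n))] in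
  measurable A /\
  mu A = (2^-1 ^+ size u * word_prob R (fun w => P (u ++ w)) n)%:E.
Proof.
elim: n u => [|n IH] u /=.
  rewrite addn0 cats0.
  have cylE : [set x : binseq | mkseq x (size u) = u] =
              [set x | forall i, (i < size u)%N -> x i = nth false u i].
    apply/seteqP; split => x /= H.
      by move=> i iu; have := congr1 (nth false ^~ i) H; rewrite /= nth_mkseq.
    apply: (@eq_from_nth _ false); rewrite size_mkseq// => i iu.
    by rewrite nth_mkseq// H.
  case: (boolP (P u)) => Pu; rewrite ?mulr1 ?mulr0.
    rewrite (_ : mkset _ = [set x : binseq | mkseq x (size u) = u]).
      by rewrite cylE; split; [exact: measurable_cylinder | rewrite mu_bernoulli].
    by apply/seteqP; split => x /= => [[]//|->]; split.
  rewrite (_ : mkset _ = set0); first by rewrite measure0.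
  by apply/seteqP; split => x //= [->]; rewrite (negbTE Pu).
have [mf ef] := IH (rcons u false); have [mt et] := IH (rcons u true).
move: mf ef mt et; rewrite !size_rcons.
set Af := [set x : binseq | _ = rcons u false /\ _].
set At := [set x : binseq | _ = rcons u true /\ _] => mf ef mt et.
have -> : [set x : binseq | mkseq x (size u) = u /\ P (mkseq x (size u + n.+1))] = Af `|` At.
  apply/seteqP; split => x /=; rewrite /Af /At /= addnS addSn !mkseqS.
    by case=> -> ?; case: (x (size u)); [right|left].
  by case=> -[/rcons_inj[-> _]].
split; first exact: measurableU.
have -> : mu (Af `|` At) = (mu Af + mu At)%E.
  apply: measureU => //.
  apply/seteqP; split => x //= -[] /= [+ _] [+ _].
  by move=> -> /rcons_inj[].
rewrite ef et -EFinD; congr EFin; rewrite exprS.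
rewrite (@word_prob_eq _ _ (fun w => P (u ++ false :: w))); last first.
  by move=> w _; rewrite cat_rcons.
rewrite [X in _ + _ * X](@word_prob_eq _ _ (fun w => P (u ++ true :: w))); last first.
  by move=> w _; rewrite cat_rcons.
by field.
Qed.

Lemma measurable_word (P : pred (seq bool)) n :
  measurable [set x : binseq | P (mkseq x n)].
Proof.
have [+ _] := cylinder_word_prob P [::] n.
by congr measurable; apply/seteqP; split => x //= [].
Qed.

Lemma mu_word (P : pred (seq bool)) n :
  mu [set x : binseq | P (mkseq x n)] = (word_prob R P n)%:E.
Proof.
have [_] := cylinder_word_prob P [::] n; rewrite /= expr0 mul1r => <-.
by congr (mu _); apply/seteqP; split => x //= [].
Qed.

End bernoulli.

(** * Runs of zeros *)

Section runs.
Context {R : realType}.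
Implicit Types (r n k q i : nat) (w : seq bool).

Definition zero_run r w := infix (nseq r false) w.

Lemma zero_run_cons r b w :
  zero_run r (b :: w) = prefix (nseq r false) (b :: w) || zero_run r w.
Proof. by rewrite /zero_run infix_consl. Qed.

Lemma zero_run_size r w : (size w < r)%N -> zero_run r w = false.
Proof.
by move=> wr; apply/negP => /size_infix; rewrite size_nseq leqNgt wr.
Qed.

Lemma zero_run_mkseq (f : nat -> bool) r n :
  reflect (exists2 k, (k + r <= n)%N & forall i, (i < r)%N -> f (k + i)%N = false)
    (zero_run r (mkseq f n)).
Proof.
rewrite /zero_run; apply: (iffP (@infixP _ _ _)) => [[s1 [s2 E]]|[k krn fk]].
  have nE : n = (size s1 + (r + size s2))%N.
    by rewrite -[LHS](size_mkseq f) E !size_cat size_nseq.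
  exists (size s1); first by rewrite nE leq_add2l leq_addr.
  move=> i ir; have := congr1 (nth true ^~ (size s1 + i)%N) E.
  rewrite /= !nth_cat size_nseq ltnNge leq_addr/= addKn ir nth_nseq ir => <-.
  by rewrite nth_mkseq// nE ltn_add2l ltn_addr.
exists (mkseq f k), (mkseq (fun i => f (k + r + i)%N) (n - (k + r))).
apply: (@eq_from_nth _ true) => [|i].
  by rewrite !size_cat !size_mkseq size_nseq; lia.
rewrite size_mkseq => iN; rewrite nth_mkseq// !nth_cat size_mkseq size_nseq.
case: ltnP => ik; first by rewrite nth_mkseq.
case: ltnP => ir; first by rewrite nth_nseq ir -(fk _ ir) subnKC.
rewrite nth_mkseq; last lia.
by congr f; lia.
Qed.

Lemma zero_run_nseq_true q i w : (i <= q)%N ->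
  zero_run q.+1 (nseq i false ++ true :: w) = zero_run q.+1 w.
Proof.
have prefF j p u : (j < p)%N -> prefix (nseq p false) (nseq j false ++ true :: u) = false.
  by elim: p j => [|p IH] [|j]//= /IH ->.
elim: i => [_|i IH iq]; first by rewrite zero_run_cons.
rewrite /= zero_run_cons IH; last exact: ltnW.
by rewrite (prefF i.+1).
Qed.

Definition no_run_prob r n : R := word_prob R (predC (zero_run r)) n.

Lemma no_run_prob_ge0 r n : 0 <= no_run_prob r n.
Proof. exact: word_prob_ge0. Qed.

Lemma no_run_prob_short r n : (n < r)%N -> no_run_prob r n = 1.
Proof.
move=> nr; rewrite -(word_probT R n); apply: word_prob_eq => w wn /=.
by rewrite zero_run_size ?wn.
Qed.

Lemma no_run_prob_diag r : no_run_prob r r = 1 - 2^-1 ^+ r.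
Proof.
rewrite /no_run_prob word_probC; congr (1 - _).
have := word_prob1 R (nseq r false); rewrite size_nseq => <-.
apply: word_prob_eq => w wr; apply/infixP/eqP => [[s1 [s2 E]]|->].
  move: wr; rewrite E !size_cat size_nseq => /eqP.
  by rewrite addnCA -{2}(addn0 r) eqn_add2l addn_eq0 => /andP[/nilP-> /nilP->]; rewrite cats0.
by exists [::], [::]; rewrite cats0.
Qed.

(** A leading [true] is harmless. A leading [false] spoils a run-free word of length [r + k] exactly
    when that word starts with [r - 1] zeros; its next bit is then [true] and the other [k] bits are
    run-free, which costs a factor [2^-r]. Averaging over the leading bit gives the remaining factor
    [1/2]. *)
Lemma no_run_prob_rec r k : (0 < r)%N ->
  no_run_prob r (r + k).+1 =
  no_run_prob r (r + k) - 2^-1 ^+ r.+1 * no_run_prob r k.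
Proof.
case: r => // q _; set r := q.+1.
have -> : no_run_prob r (r + k).+1 =
    (word_prob R (fun w => ~~ zero_run r (false :: w)) (r + k) +
     word_prob R (fun w => ~~ zero_run r (true :: w)) (r + k)) / 2 by [].
pose Q : pred (seq bool) := fun w =>
  (take r w == rcons (nseq q false) true) && ~~ zero_run r (drop r w).
have -> : word_prob R (fun w => ~~ zero_run r (true :: w)) (r + k) =
    no_run_prob r (r + k).
  by apply: word_prob_eq => w _; rewrite /= (@zero_run_nseq_true q 0).
have -> : word_prob R (fun w => ~~ zero_run r (false :: w)) (r + k) =
    no_run_prob r (r + k) - word_prob R Q (r + k).
  rewrite /no_run_prob (word_probD R (predC (zero_run r)) (prefix (nseq q false))).
  rewrite [X in _ = X + _ - _](@word_prob_eq _ _ Q); last first.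
    move=> w sw; rewrite /= /Q.
    have [u uq [b [v ->]]] : exists2 u, size u = q & exists b v, w = u ++ b :: v.
      exists (take q w); first by rewrite size_takel// sw /r; lia.
      exists (nth false w q), (drop q.+1 w).
      by rewrite -drop_nth ?cat_take_drop// sw /r; lia.
    rewrite -cat_rcons take_size_cat ?drop_size_cat ?size_rcons ?uq//.
    rewrite eqseq_rcons cat_rcons prefixE size_nseq take_size_cat//.
    case: eqP => [->|]; rewrite ?andbF//= andbT.
    case: b => /=; first by rewrite zero_run_nseq_true.
    rewrite (_ : zero_run r _ = true)// /zero_run.
    apply/infixP; exists [::], v.
    by rewrite -cat_rcons -cats1 -[[:: false]]/(nseq 1 false) -nseqD addn1.
  rewrite addrAC subrr add0r; apply: word_prob_eq => w _ /=.
  by rewrite zero_run_cons /= negb_or andbC.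
rewrite (word_prob_cat R (pred1 (rcons (nseq q false) true)) (predC (zero_run r)) r k).
have := word_prob1 R (rcons (nseq q false) true).
rewrite size_rcons size_nseq => ->.
by rewrite -/(no_run_prob r k) -/r [2^-1 ^+ r.+1]exprS; field.
Qed.

Lemma no_run_probS_le r n : no_run_prob r n.+1 <= no_run_prob r n.
Proof.
have le b : word_prob R (fun w => ~~ zero_run r (b :: w)) n <= no_run_prob r n.
  by apply: word_prob_le => w _ /=; rewrite zero_run_cons negb_or => /andP[].
have -> : no_run_prob r n.+1 =
    (word_prob R (fun w => ~~ zero_run r (false :: w)) n +
     word_prob R (fun w => ~~ zero_run r (true :: w)) n) / 2 by [].
by move: (le true) (le false) => /= lt lf; lra.
Qed.

Lemma no_run_prob_anti r n m : (n <= m)%N -> no_run_prob r m <= no_run_prob r n.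
Proof.
move=> /subnKC <-; elim: (m - n)%N => [|k IH]; first by rewrite addn0.
by rewrite addnS (le_trans (no_run_probS_le _ _)).
Qed.

(** By monotonicity the subtracted term of the recursion is at least [2^-(r+1)] times the current
    value, so the decay is geometric. *)
Lemma no_run_prob_ub r k : (0 < r)%N ->
  no_run_prob r (r + k) <= (1 - 2^-1 ^+ r.+1) ^+ k.+1.
Proof.
move=> r0; have x0 : 0 <= (2^-1 : R) ^+ r.+1 by rewrite exprn_ge0.
have x1 : (2^-1 : R) ^+ r.+1 <= 1 by apply: exprn_ile1; lra.
elim: k => [|k IH].
  rewrite addn0 no_run_prob_diag expr1 lerD2l lerN2 exprS.
  by have x0' : 0 <= (2^-1 : R) ^+ r; [exact: exprn_ge0|lra].
rewrite addnS no_run_prob_rec// [X in _ <= X]exprS.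
have kr := @no_run_prob_anti r k (r + k) (leq_addl _ _).
apply: (@le_trans _ _ ((1 - 2^-1 ^+ r.+1) * no_run_prob r (r + k))).
  by rewrite mulrBl mul1r lerD2l lerN2 ler_wpM2l.
by rewrite ler_wpM2l// subr_ge0.
Qed.

Lemma muln4_le_exp2 r : (4 <= r)%N -> (4 * r <= 2 ^ r)%N.
Proof.
move=> /subnKC <-; elim: (r - 4)%N => [//|k IH].
by rewrite addnS expnS; lia.
Qed.

Lemma bernoulli_inequality (x : R) n : 0 <= x <= 1 -> 1 - n%:R * x <= (1 - x) ^+ n.
Proof.
move=> /andP[x0 x1]; elim: n => [|n IH]; first by rewrite mul0r subr0 expr0.
have nx : 0 <= n%:R * x * x by rewrite !mulr_ge0.
rewrite exprS; apply: (@le_trans _ _ ((1 - x) * (1 - n%:R * x))).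
  by rewrite -natr1; nra.
by rewrite ler_wpM2l// subr_ge0.
Qed.

Let natr_expr_half_le r : (4 <= r)%N -> r%:R * 2^-1 ^+ r <= (4^-1 : R).
Proof.
move=> r4; have := muln4_le_exp2 r4; rewrite -(ler_nat R) natrM natrX => h.
by rewrite exprVn ler_pdivrMr ?exprn_gt0//; lra.
Qed.

Lemma no_run_prob_iter (l : R) r k j : 0 <= l ->
  (forall i, (i < j)%N -> l * no_run_prob r (k + i) <= no_run_prob r (k + i).+1) ->
  l ^+ j * no_run_prob r k <= no_run_prob r (k + j).
Proof.
move=> l0; elim: j => [|j IH] h; first by rewrite addn0 expr0 mul1r.
rewrite addnS (le_trans _ (h j _))// exprS -mulrA ler_wpM2l// IH// => i ij.
by apply: h; exact: ltnW.
Qed.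

(** Strong induction: the ratio bound over the previous [r] steps and Bernoulli's inequality give
    [p(k) >= (1 - r 2^-r) p(k-r) >= p(k-r) / 2]. Hence the loss [2^-(r+1) p(k-r)] in the recursion
    is at most [2^-r p(k)]. *)
Lemma no_run_prob_ratio r k : (4 <= r)%N ->
  (1 - 2^-1 ^+ r) * no_run_prob r k <= no_run_prob r k.+1.
Proof.
move=> r4; set x : R := 2^-1 ^+ r.
have x0 : 0 <= x by exact: exprn_ge0.
have rx := natr_expr_half_le r4; rewrite -/x in rx.
have x1 : x <= 4^-1.
  by apply: le_trans rx; rewrite -[leLHS]mul1r ler_wpM2r// ler1n; lia.
have [n] := ubnP k; elim: n k => // n IH k; rewrite ltnS => kn.
have [kr|] := ltnP k.+1 r.
  by rewrite !no_run_prob_short ?mulr1 ?lerBlDr ?lerDl//; exact: ltnW.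
rewrite leq_eqVlt => /predU1P[rk|].
  by rewrite -rk no_run_prob_diag (@no_run_prob_short r k) ?mulr1// rk.
rewrite ltnS => rk.
have bern : 1 - r%:R * x <= (1 - x) ^+ r.
  by apply: bernoulli_inequality; lra.
have half : 2^-1 * no_run_prob r (k - r) <= no_run_prob r k.
  apply: (@le_trans _ _ ((1 - x) ^+ r * no_run_prob r (k - r))).
    by rewrite ler_wpM2r ?no_run_prob_ge0//; lra.
  rewrite -[in leRHS](subnK rk); apply: no_run_prob_iter; first lra.
  by move=> i ir; apply: IH; lia.
have := @no_run_prob_rec r (k - r); rewrite subnKC// => ->; last lia.
rewrite mulrBl mul1r lerD2l lerN2 exprSr -/x -mulrA ler_wpM2l//.
Qed.

(** A converse to monotonicity, up to a constant: it replaces [p(k)] by [p(r+k)] in the recursion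
    when a lower bound is wanted. *)
Lemma no_run_prob_overlap r k : (4 <= r)%N ->
  3 / 4 * no_run_prob r k <= no_run_prob r (r + k).
Proof.
move=> r4; have x0 : 0 <= (2^-1 : R) ^+ r by exact: exprn_ge0.
have rx := natr_expr_half_le r4.
have x1 : (2^-1 : R) ^+ r <= 4^-1.
  by apply: le_trans rx; rewrite -[leLHS]mul1r ler_wpM2r// ler1n; lia.
have bern : 1 - r%:R * 2^-1 ^+ r <= (1 - 2^-1 ^+ r) ^+ r :> R.
  by apply: bernoulli_inequality; lra.
apply: (@le_trans _ _ ((1 - 2^-1 ^+ r) ^+ r * no_run_prob r k)).
  by rewrite ler_wpM2r ?no_run_prob_ge0//; lra.
rewrite addnC; apply: no_run_prob_iter; first lra.
by move=> i _; exact: no_run_prob_ratio.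
Qed.

(* [3/4] loses a constant in the exponent against the true [1/2]; any value
   below [1] suffices for the divergence argument. *)
Lemma no_run_prob_lb r k : (4 <= r)%N ->
  2^-1 * expR (- (3 / 4 * 2^-1 ^+ r * k%:R)) <= no_run_prob r (r + k).
Proof.
move=> r4; set x : R := 2^-1 ^+ r.
have x0 : 0 <= x by exact: exprn_ge0.
have x1 : x <= 16^-1.
  rewrite /x exprVn lef_pV2 ?posrE ?exprn_gt0//.
  have -> : 16 = 2 ^+ 4 :> R by rewrite -natrX.
  by rewrite ler_eXn2l// ltr1n.
(* The [2 / 3] is the [4 / 3] lost in [no_run_prob_overlap] times the [1 / 2] of the recursion. The
   inequality follows from [(1 - 2x/3)(1 + 3x/4) >= 1], true for [0 <= x <= 1/6]. *)
have exp_le : expR (- (3 / 4 * x)) <= 1 - 2 / 3 * x.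
  rewrite expRN -[leRHS]invrK lef_pV2 ?posrE ?expR_gt0 ?invr_gt0//; last by lra.
  apply: le_trans (expR_ge1Dx _).
  by rewrite -[leLHS]mul1r ler_pdivrMr; [nra|lra].
apply: (@le_trans _ _ ((1 - 2 / 3 * x) ^+ k * no_run_prob r r)).
  rewrite no_run_prob_diag -/x [leRHS]mulrC ler_pM ?expR_ge0//; first by lra.
  by rewrite -mulNr expRM_natr lerXn2r ?nnegrE ?expR_ge0//; lra.
apply: no_run_prob_iter => [|i _]; first by lra.
rewrite no_run_prob_rec; last lia.
have := no_run_prob_overlap i r4; rewrite [2^-1 ^+ r.+1]exprS -/x => h.
have p0 := @no_run_prob_ge0 r i.
nra.
Qed.

End runs.

(** * Runs at several scales *)

Section scales.
Context {R : realType}.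
Implicit Types (s M L n : nat).

Lemma word_prob_prefix s n :
  word_prob R (prefix (nseq s false)) n <= 2^-1 ^+ s.
Proof.
elim: s n => [|s IH] n; first by rewrite expr0; exact: word_prob_le1.
have s0 : 0 <= (2^-1 : R) ^+ s.+1 by exact: exprn_ge0.
case: n => [|n] //.
have -> : word_prob R (prefix (nseq s.+1 false)) n.+1 =
  (word_prob R (prefix (nseq s false)) n + word_prob R pred0 n) / 2 by [].
by rewrite word_prob0 addr0 exprSr ler_wpM2r.
Qed.

(* The event is that some run starts before position [M]: union bound over the
   starting point. *)
Lemma word_prob_early_run s M n :
  word_prob R (fun w => zero_run s w && ~~ zero_run s (drop M w)) n <=
  M%:R * 2^-1 ^+ s.
Proof.
have s0 : 0 <= (2^-1 : R) ^+ s by exact: exprn_ge0.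
elim: M n => [|M IH] n.
  rewrite mul0r -(word_prob0 R n); apply: word_prob_le => w _.
  by rewrite drop0 andbN.
case: n => [|n].
  by rewrite /= andbN mulr_ge0.
rewrite -natr1 mulrDl mul1r addrC.
pose Q w := zero_run s (behead w) && ~~ zero_run s (drop M (behead w)).
apply: (@le_trans _ _ (word_prob R (predU (prefix (nseq s false)) Q) n.+1)).
  apply: word_prob_le => -[//|b w] _; rewrite zero_run_cons => /andP[/orP[pw _|rw dw]].
    by apply/orP; left.
  by apply/orP; right; apply/andP.
apply: le_trans (word_probU _ _ _ _) _; rewrite lerD ?word_prob_prefix//.
have -> : word_prob R Q n.+1 =
  (word_prob R (fun w => zero_run s w && ~~ zero_run s (drop M w)) n +
   word_prob R (fun w => zero_run s w && ~~ zero_run s (drop M w)) n) / 2 by [].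
by move: (IH n) => ?; lra.
Qed.

(** Either the run lies in the last [L] bits, independently of [A], or it starts before position
    [M], which the union bound makes rare. *)
Lemma word_prob_next_run (A : pred (seq bool)) s M L :
  word_prob R (fun w => A (take M w) && zero_run s w) (M + L) <=
  (1 - no_run_prob s L) * word_prob R A M + M%:R * 2^-1 ^+ s.
Proof.
pose Q w := A (take M w) && zero_run s (drop M w).
apply: (@le_trans _ _ (word_prob R (predU Q
    (fun w => zero_run s w && ~~ zero_run s (drop M w))) (M + L))).
  apply: word_prob_le => w _ /andP[Aw rw] /=.
  by rewrite /Q Aw rw /=; case: zero_run.
apply: le_trans (word_probU _ _ _ _) _; rewrite lerD ?word_prob_early_run//.
rewrite /Q word_prob_cat mulrC /no_run_prob word_probC.
by rewrite opprB addrC subrK.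
Qed.

(** Only scales [1] to [K] are tested; [M 0] merely marks where the first block begins. *)
Definition all_runs (s M : nat -> nat) K (w : seq bool) :=
  all (fun j => zero_run (s j.+1) (take (M j.+1) w)) (iota 0 K).

(** One more block turns the bound [q] into [(1 - p) q + e], and [e / p] is the fixed point of this
    map. *)
Lemma word_prob_all_runs (s M : nat -> nat) (p e : R) K :
  {homo M : i j / (i <= j)%N} -> 0 < p <= 1 -> 0 <= e ->
  (forall j, (j < K)%N -> p <= no_run_prob (s j.+1) (M j.+1 - M j)) ->
  (forall j, (j < K)%N -> (M j)%:R * 2^-1 ^+ s j.+1 <= e) ->
  word_prob R (all_runs s M K) (M K) <= (1 - p) ^+ K + e / p.
Proof.
move=> homoM /andP[p0 p1] e0 hp he.
elim: K hp he => [|K IH] hp he.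
  by rewrite expr0 (le_trans (word_prob_le1 _ _ _))// lerDl divr_ge0// ltW.
have MK : (M K <= M K.+1)%N by exact: homoM.
have -> : word_prob R (all_runs s M K.+1) (M K.+1) =
    word_prob R (fun w => all_runs s M K (take (M K) w) && zero_run (s K.+1) w)
      (M K + (M K.+1 - M K)).
  rewrite subnKC//; apply: word_prob_eq => w sw.
  rewrite /all_runs -addn1 iotaD add0n all_cat /= andbT addn1 -sw take_size.
  congr (_ && _); apply: eq_in_all => j; rewrite mem_iota add0n => /= jK.
  by rewrite take_takel// homoM.
apply: le_trans (word_prob_next_run _ _ _ _) _.
have q0 : 0 <= word_prob R (all_runs s M K) (M K) by exact: word_prob_ge0.
apply: (@le_trans _ _ ((1 - p) * ((1 - p) ^+ K + e / p) + e)).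
  rewrite lerD ?he//.
  apply: (@le_trans _ _ ((1 - p) * word_prob R (all_runs s M K) (M K))).
    by rewrite ler_wpM2r// lerD2l lerN2 hp.
  rewrite ler_wpM2l ?subr_ge0// IH// => j jK; [apply: hp|apply: he]; exact: ltnW.
rewrite exprS mulrDr -addrA lerD2l le_eqVlt; apply/orP; left; apply/eqP.
by field; rewrite gt_eqF.
Qed.

End scales.

(** * Hitting zero cylinders *)

Lemma iter_shift k (x : binseq) i : iter k Defs.shift x i = x (k + i)%N.
Proof. by elim: k i => [|k IH] i //=; rewrite /Defs.shift IH addnS addSn. Qed.

Lemma orbit_hits_cylinder (x : binseq) m n :
  (forward_orbit m x `&` zero_cylinder n !=set0) <->
  exists2 k, (1 <= k <= m)%N & forall i, (i < n)%N -> x (k + i)%N = false.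
Proof.
split => [[_ [[k km <-] xk]]|[k km xk]].
  by exists k => // i /xk; rewrite iter_shift.
by exists (iter k Defs.shift x); split; [exists k|move=> i; rewrite iter_shift; exact: xk].
Qed.

Lemma orbit_hits_zero_run (x : binseq) m n s : (s <= n)%N ->
  forward_orbit m x `&` zero_cylinder n !=set0 -> zero_run s (mkseq x (m + s)).
Proof.
move=> sn /orbit_hits_cylinder[k /andP[_ km] xk]; apply/zero_run_mkseq.
by exists k => [|i /leq_trans/(_ sn)/xk]; first by rewrite leq_add2r.
Qed.

(** * Choice of scales for the zero-measure half *)

Section divergence.
Context {R : realType}.

(** One [u], the integer just above [ln (4 S)], serves all scales up to [2 S]: both [s ln 2] and
    [ln u] are at most [2 S], so [ln (2^s u) <= 4 S]. *)
Lemma lnln_scale_lt (S s u : nat) : (0 < S)%N -> (s <= 2 * S)%N -> (0 < u)%N ->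
  ln (4 * S%:R) < u%:R :> R -> u%:R <= ln (4 * S%:R) + 1 :> R ->
  ln (ln (2 ^ s * u)%:R) < u%:R :> R.
Proof.
move=> S0 sS u0 u1 u2.
have Sp : 1 <= S%:R :> R by rewrite ler1n.
have ln_le x : 0 < x -> ln x <= x - 1 :> R.
  by move=> x0; have := @le_ln1Dx R (x - 1); rewrite (addrC 1) subrK; apply; lra.
have ln2 : ln 2 <= 1 :> R by rewrite (le_trans (ln_le 2 _)) ?ltr0n//; lra.
have ln4S : ln (4 * S%:R) <= 2 * S%:R :> R.
  have -> : 4 * S%:R = 2 * (2 * S%:R) :> R by ring.
  rewrite lnM ?posrE; [|lra|lra].
  have a : ln (2 * S%:R) <= 2 * S%:R - 1 :> R by apply: ln_le; lra.
  by move: ln2; lra.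
have up : 0 < u%:R :> R by rewrite ltr0n.
have s2 : s%:R <= 2 * S%:R :> R by rewrite -natrM ler_nat.
have lnm : ln (2 ^ s * u)%:R <= 4 * S%:R :> R.
  rewrite natrM lnM ?posrE ?ltr0n ?expn_gt0// natrX lnXn// -[ln 2 *+ s]mulr_natl.
  have : s%:R * ln 2 <= s%:R :> R.
    by rewrite ler_piMr.
  move: (ln_le _ up) => a b; lra.
(* By convention [ln] vanishes at nonpositive arguments. *)
have [m1|m1] := leP (ln (2 ^ s * u)%:R : R) 0.
  by rewrite ln0.
by apply: le_lt_trans u1; rewrite ler_ln ?posrE//; lra.
Qed.

(** The constant [2] enters here: with [m = 2^s u] and [ln (ln m) < u], the bound gives
    [2^-rho < 2^-(s-1)]. The inequality is strict, so the integer [rho] is at least [s]. *)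
Lemma level_at_scale (s u rho : nat) : (0 < u)%N ->
  ln (ln (2 ^ s * u)%:R) < u%:R :> R ->
  2^-1 ^+ rho <= 2 * ln (ln (2 ^ s * u)%:R) / (2 ^ s * u)%:R :> R ->
  (s <= rho)%N.
Proof.
move=> u0 lu h; rewrite leqNgt; apply/negP => rs.
rewrite natrM natrX in lu h.
have up : 0 < u%:R :> R by rewrite ltr0n.
have sp : 0 < (2 : R) ^+ s by rewrite exprn_gt0.
have : 2^-1 ^+ rho < 2 * 2^-1 ^+ s :> R.
  apply: le_lt_trans h _.
  rewrite exprVn ltr_pdivrMr ?mulr_gt0//.
  by rewrite mulrA -(mulrA 2) mulVf ?gt_eqF// mulr1 ltr_pM2l.
rewrite -[s]prednK; last by apply: leq_ltn_trans rs.
rewrite exprS mulrA divff// mul1r ltNge => /negP; apply.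
apply: ler_wiXn2l; [lra|lra|].
by rewrite -ltnS prednK//; apply: leq_ltn_trans rs.
Qed.

Lemma no_run_prob_scale (s u n : nat) : (4 <= s)%N -> (n <= s + 2 ^ s * u)%N ->
  2^-1 * expR (- (3 / 4 * u%:R)) <= no_run_prob s n :> R.
Proof.
move=> s4 nb; apply: le_trans (no_run_prob_anti _ nb).
apply: le_trans (no_run_prob_lb _ s4); rewrite natrM natrX exprVn.
have -> : 3 / 4 * (2 ^+ s)^-1 * (2 ^+ s * u%:R) = 3 / 4 * u%:R :> R.
  by field; rewrite expf_neq0.
by [].
Qed.

(* The [2 ^ (7 * b)] scales lie between [2 ^ (8 * b)] and twice that, at distance
   [2 ^ b]; each block fails with probability at least of order [2 ^- (6 * b)]. *)
Lemma block_of_scales (b : nat) : (7 <= b)%N ->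
  exists u K (s : nat -> nat),
  [/\ (0 < u)%N, {homo s : i j / (i <= j)%N},
      forall j, (j <= K)%N -> (b <= s j)%N /\ ln (ln (2 ^ s j * u)%:R) < u%:R :> R
    & word_prob R (all_runs s (fun j => 2 ^ s j * u + s j)%N K) (2 ^ s K * u + s K)
      <= 56 * expR 1 / 2 ^+ b].
Proof.
move=> b7; pose S := (2 ^ (8 * b))%N.
have S0 : (0 < S)%N by rewrite expn_gt0.
have Sp : 1 <= S%:R :> R by rewrite ler1n.
pose t : R := ln (4 * S%:R).
have t0 : 0 <= t by apply: ln_ge0; lra.
pose u := (Num.truncn t).+1.
have [u2 u1] : u%:R <= t + 1 /\ t < u%:R.
  by have /andP[a c] := truncn_itv t0; split => //; rewrite /u -natr1 lerD2r.
have u1' : 1 <= u%:R :> R by rewrite ler1n.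
pose K := (2 ^ (7 * b))%N; pose s j := (S + j * 2 ^ b)%N.
(* Of the exponent [15 * b], [8 * b] will absorb the factor [u + 1] and [7 * b] will match [K]. The
   induction starts from [15 * 7 <= 2 ^ 7]. *)
have b15 : (15 * b <= 2 ^ b)%N.
  move: b7 => /subnKC <-; elim: (b - 7)%N => // k IH.
  by rewrite addnS expnS; lia.
have sb j : (b <= s j)%N.
  apply: leq_trans (leq_addr _ _); apply: leq_trans (ltnW (ltn_expl _ (ltnSn 1))).
  by rewrite leq_pmull.
(* The last scale is exactly [2 * S], since [K * 2 ^ b = S]. *)
have sS j : (j <= K)%N -> (s j <= 2 * S)%N.
  move=> jK; rewrite mul2n -addnn leq_add2l /S (_ : 8 * b = 7 * b + b)%N; last lia.
  by rewrite expnD leq_mul.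
have sM : {homo s : i j / (i <= j)%N} by move=> i j ij; rewrite leq_add2l leq_mul2r ij orbT.
exists u, K, s; split => // [j jK|].
  by split => //; exact: (lnln_scale_lt S0 (sS _ jK)).
set M := fun j => (2 ^ s j * u + s j)%N.
pose p : R := 2^-1 * expR (- (3 / 4 * u%:R)).
pose e : R := (u%:R + 1) / 2 ^+ (15 * b).
have p0 : 0 < p by rewrite mulr_gt0 ?expR_gt0 ?invr_gt0.
have p1 : p <= 1.
  have ? : expR (- (3 / 4 * u%:R)) <= 1 :> R by rewrite -[leRHS]expR0 ler_expR; lra.
  by rewrite /p; lra.
have e0 : 0 <= e by rewrite divr_ge0 ?exprn_ge0//; lra.
have MM : {homo M : i j / (i <= j)%N}.
  by move=> i j /sM ij; rewrite leq_add// leq_mul2r leq_pexp2l// orbT.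
have s4 j : (4 <= s j)%N by apply: leq_trans (sb j); lia.
have hp j : p <= no_run_prob (s j.+1) (M j.+1 - M j).
  apply: no_run_prob_scale => //; rewrite addnC; exact: leq_subr.
have he j : (M j)%:R * 2^-1 ^+ s j.+1 <= e.
  rewrite /e exprVn.
  have -> : s j.+1 = (s j + 2 ^ b)%N by rewrite /s mulSn; lia.
  have M1 : (M j)%:R <= (u%:R + 1) * 2 ^+ s j :> R.
    rewrite natr1 -natrX -natrM ler_nat /M mulSn mulnC addnC leq_add2r.
    exact/ltnW/ltn_expl.
  rewrite exprD invfM mulrA.
  apply: (@le_trans _ _ ((u%:R + 1) / 2 ^+ (2 ^ b))).
    by rewrite ler_wpM2r ?invr_ge0 ?exprn_ge0// ler_pdivrMr ?exprn_gt0.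
  rewrite ler_wpM2l//.
  by rewrite lef_pV2 ?posrE ?exprn_gt0// ler_eXn2l// ltr1n.
apply: (le_trans (@word_prob_all_runs R s M p e K MM _ e0 (fun j _ => hp j) (fun j _ => he j))).
  by rewrite p0.
(* Here [u <= t + 1] with [t = (8 b + 2) ln 2], and the factor [3 / 4] in the exponent turns [8 b]
   into [6 b]. The number of scales, [2 ^ (7 * b)], therefore exceeds [p^-1] by a factor of order
   [2 ^ b]. *)
have pinv : p^-1 <= 8 * expR 1 * 2 ^+ (6 * b).
  have tE : t = (8 * b)%:R * ln 2 + 2 * ln 2.
    have ln4 : ln 4 = 2 * ln 2 :> R.
      have -> : 4 = 2 ^+ 2 :> R by ring.
      by rewrite lnXn// [RHS]mulr_natl.
    rewrite /t /S natrX lnM ?posrE ?exprn_gt0// ln4 lnXn// -[ln 2 *+ _]mulr_natl.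
    exact: addrC.
  rewrite /p invfM invrK -expRN opprK.
  apply: (@le_trans _ _ (2 * (expR 1 * expR ((6 * b + 2)%:R * ln 2)))); last first.
    rewrite expRM_natl lnK ?posrE// exprD; lra.
  rewrite ler_pM2l// -expRD ler_expR.
  have l2 : 0 <= ln 2 :> R by apply: ln_ge0; lra.
  rewrite natrD natrM; move: tE; rewrite natrM => tE.
  have ? : 3 / 4 * u%:R <= 3 / 4 * (t + 1) by rewrite ler_pM2l//; lra.
  lra.
(* The crude bound [exp (- p K) <= 1 / (p K)] is enough. *)
have KpE : (1 - p) ^+ K <= p^-1 / 2 ^+ (7 * b).
  apply: (@le_trans _ _ (expR (- p) ^+ K)).
    by rewrite lerXn2r ?nnegrE ?expR_ge0 ?subr_ge0//; exact: expR_ge1Dx.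
  rewrite -expRM_natr mulNr expRN -invfM /K natrX lef_pV2 ?posrE ?expR_gt0//; last first.
    by rewrite mulr_gt0 ?exprn_gt0.
  by apply: le_trans (expR_ge1Dx _); rewrite lerDr.
have ep : e / p <= 6 * p^-1 / 2 ^+ (7 * b).
  rewrite /e [leRHS]mulrAC ler_pM2r ?invr_gt0//.
  rewrite (_ : 15 * b = 8 * b + 7 * b)%N; last lia.
  rewrite exprD invfM mulrA ler_pM2r ?invr_gt0 ?exprn_gt0//.
  rewrite ler_pdivrMr ?exprn_gt0// -natrX -/S.
  have ? : t < 4 * S%:R by apply: ln_sublinear; lra.
  lra.
apply: (@le_trans _ _ (7 * p^-1 / 2 ^+ (7 * b))).
  apply: le_trans (lerD KpE ep) _; rewrite -mulrDl.
  by rewrite ler_wpM2r ?invr_ge0 ?exprn_ge0//; lra.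
rewrite ler_pdivrMr ?exprn_gt0//.
rewrite (_ : 7 * b = b + 6 * b)%N; last lia.
by rewrite exprD mulrA divfK ?expf_neq0//; lra.
Qed.

End divergence.

(** * Summable bounds for the full-measure half *)

Section convergence.
Context {R : realType}.

Lemma nneseries_telescope_fin (f : nat -> \bar R) (g : nat -> R) :
  (forall n, 0 <= f n)%E -> (forall n, 0 <= g n) ->
  (forall n, f n <= (g n - g n.+1)%:E)%E ->
  (\sum_(n <oo) f n < +oo)%E.
Proof.
move=> f0 g0 fg; apply: (@le_lt_trans _ _ (g 0%N)%:E); last exact: ltry.
apply: lime_le; first exact: is_cvg_nneseries.
apply: nearW => n.
apply: (@le_trans _ _ (g 0%N - g n)%:E); last by rewrite lee_fin lerBlDr lerDl.
elim: n => [|n IH]; first by rewrite big_nil subrr.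
rewrite big_nat_recr//= (_ : g 0%N - g n.+1 = (g 0%N - g n) + (g n - g n.+1)); last by ring.
by rewrite EFinD leeD.
Qed.

(** Convergence of the series of [n^-(1+d)] by comparison with differences of [n^-d], powers being
    written through [expR] and [ln]. It rests on [ln (n+1) - ln n >= 1 / (n+1)] and
    [exp y >= 1 + y]. *)
Lemma power_telescope (d : R) n : 0 < d -> (0 < n)%N ->
  d * expR (- ((1 + d) * ln n.+1%:R)) <=
  expR (- (d * ln n%:R)) - expR (- (d * ln n.+1%:R)).
Proof.
move=> d0 n0; have np : 0 < n%:R :> R by rewrite ltr0n.
have n1p : 0 < n.+1%:R :> R by rewrite ltr0n.
have ln_step : n.+1%:R^-1 <= ln n.+1%:R - ln n%:R :> R.
  have h := @le_ln1Dx R (- n.+1%:R^-1).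
  have e : 1 - n.+1%:R^-1 = n%:R / n.+1%:R :> R.
    by rewrite -natr1; field; rewrite natr1 gt_eqF.
  rewrite e ln_div ?posrE// in h.
  have i1 : n.+1%:R^-1 < 1 :> R by rewrite invf_lt1// ltr1n.
  move: h; rewrite ltrN2 => /(_ i1) h; by rewrite -lerN2 opprB.
set E := expR (- (d * ln n.+1%:R)).
have -> : expR (- ((1 + d) * ln n.+1%:R)) = n.+1%:R^-1 * E.
  by rewrite mulrDl mul1r opprD expRD [X in X * _]expRN lnK ?posrE.
have -> : expR (- (d * ln n%:R)) = E * expR (d * (ln n.+1%:R - ln n%:R)).
  by rewrite -expRD; congr expR; ring.
have E0 : 0 < E by exact: expR_gt0.
have h1 : 1 + d * n.+1%:R^-1 <= expR (d * (ln n.+1%:R - ln n%:R)).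
  by apply: le_trans (expR_ge1Dx _) _; rewrite ler_expR ler_pM2l.
have := ler_wpM2l (ltW E0) h1; rewrite mulrDr mulr1 => h2.
by rewrite lerBrDl; apply: le_trans h2; rewrite lerD2l mulrA mulrC.
Qed.

Lemma no_run_prob_le_expR r k : (0 < r)%N ->
  no_run_prob r (r + k) <= expR (- (k.+1%:R / 2 ^+ r.+1)) :> R.
Proof.
move=> r0; apply: le_trans (no_run_prob_ub _ r0) _.
rewrite mulrC -mulNr expRM_natr lerXn2r ?nnegrE ?expR_ge0//.
  by rewrite subr_ge0; apply: exprn_ile1; lra.
by rewrite -exprVn; exact: expR_ge1Dx.
Qed.

(** The hypothesis says [a / 2^rho >= D ln ln a]. As the right side is at least [1], this yields
    [2^rho <= a] and so [ln a >= rho ln 2]; fed back, it gives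
    [a / 2^(rho+1) >= D/2 (ln rho + ln ln 2)]. *)
Lemma rare_miss_bound (D : R) (a rho : nat) : 2 < D -> (0 < rho)%N ->
  1 <= ln (ln a%:R) :> R -> D * ln (ln a%:R) / a%:R <= 2^-1 ^+ rho ->
  expR (- (a%:R / 2 ^+ rho.+1)) <=
  expR (- (D / 2 * ln (ln 2))) * expR (- (D / 2 * ln rho%:R)).
Proof.
move=> D2 rho0 lla h; rewrite -expRD ler_expR.
have a0 : 0 < a%:R :> R.
  by rewrite ltr0n lt0n; apply/eqP => a0; move: lla; rewrite a0 !ln0// ler10.
have x0 : 0 < (2 : R) ^+ rho by rewrite exprn_gt0.
rewrite exprVn ler_pdivrMr// in h.
have ap : 2 ^+ rho <= a%:R :> R.
  have : 1 <= a%:R / 2 ^+ rho :> R by rewrite mulrC; apply: le_trans h; nra.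
  by rewrite ler_pdivlMr// mul1r.
have rp : 0 < rho%:R :> R by rewrite ltr0n.
have l2 : 0 < ln 2 :> R by apply: ln_gt0; lra.
have la : rho%:R * ln 2 <= ln a%:R :> R.
  by rewrite mulr_natl -lnXn// ler_ln ?posrE.
have lla2 : ln rho%:R + ln (ln 2) <= ln (ln a%:R) :> R.
  by rewrite -lnM ?posrE// ler_ln ?posrE ?mulr_gt0// (lt_le_trans _ la)// mulr_gt0.
rewrite exprS invfM; set y := (2 ^+ rho)^-1 in h *.
nra.
Qed.

End convergence.

Lemma behead_mkseq {T : Type} (f : nat -> T) n :
  behead (mkseq f n.+1) = mkseq (fun i => f i.+1) n.
Proof.
apply: (@eq_from_nth _ (f 0%N)); rewrite size_behead !size_mkseq// => i ni.
by rewrite nth_behead !nth_mkseq.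
Qed.

(** * The two halves for a given sequence of levels *)

Section main.
Context {R : realType} (mu : probability binseq R) (mu_bernoulli : fair_bernoulli mu).
Context (r : nat -> nat).
Context (r_nondecreasing : forall m n, (1 <= m)%N -> (m <= n)%N -> (r m <= r n)%N).
Context (r_unbounded : forall M, exists m, (1 <= m)%N /\ (M <= r m)%N).

Let B (m : nat) : set binseq := zero_cylinder (r m).

Lemma measurable_zero_cylinder n : measurable (zero_cylinder n).
Proof. exact: measurable_cylinder. Qed.

Lemma mu_zero_cylinder n : mu (zero_cylinder n) = (2^-1 ^+ n)%:E.
Proof. exact: mu_bernoulli. Qed.

(* Position [0] is skipped because orbits start at [shift x]. *)
Definition miss (s a : nat) : set binseq :=
  [set x | ~~ zero_run s (mkseq (fun i => x i.+1) (s + a))].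

Lemma miss_word s a :
  miss s a = [set x : binseq | (fun w => ~~ zero_run s (behead w)) (mkseq x (s + a).+1)].
Proof. by apply/seteqP; split => x; rewrite /miss /= -(behead_mkseq x). Qed.

Lemma measurable_miss s a : measurable (miss s a).
Proof.
by rewrite miss_word; exact: measurable_word mu_bernoulli (fun w => ~~ zero_run s (behead w)) _.
Qed.

Lemma mu_miss s a : mu (miss s a) = (no_run_prob s (s + a))%:E.
Proof.
rewrite miss_word; have := mu_word mu_bernoulli (fun w => ~~ zero_run s (behead w)) (s + a).+1.
move=> ->; congr EFin.
have -> : word_prob R (fun w => ~~ zero_run s (behead w)) (s + a).+1 =
  (no_run_prob s (s + a) + no_run_prob s (s + a)) / 2 by [].
by field.
Qed.

Lemma miss_anti s a b : (a <= b)%N -> miss s b `<=` miss s a.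
Proof.
move=> ab x; apply: contra => /zero_run_mkseq[k ks xk].
by apply/zero_run_mkseq; exists k => //; apply: leq_trans ks _; rewrite leq_add2l.
Qed.

(** Starting positions [1] to [m] become [0] to [m - 1] once the first bit is dropped, hence the
    index [m.-1]. *)
Lemma miss_of_no_hit x m n : (0 < m)%N ->
  ~ (forward_orbit m x `&` zero_cylinder n !=set0) -> miss n m.-1 x.
Proof.
move=> m0 nhit; apply/negP => /zero_run_mkseq[k ks xk]; apply: nhit.
by apply/orbit_hits_cylinder; exists k.+1 => //; lia.
Qed.

Let B_measurable : measurable (eventually_always_hitting B).
Proof. by apply: measurable_eventually_always_hitting => m; exact: measurable_zero_cylinder. Qed.

Lemma full_measure (D : R) : 2 < D ->
  (\forall m \near \oo, ((D * ln (ln m%:R) / m%:R)%:E <= mu (B m))%E) ->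
  mu (eventually_always_hitting B) = 1%E.
Proof.
move=> D2 [N0 _ hN0].
have first_ex s : exists m, (1 <= m)%N && (s <= r m)%N.
  by have [m [m1 sm]] := r_unbounded s; exists m; rewrite m1.
pose a s := ex_minn (first_ex s).
(* Beyond [N1] one has [ln (ln m) >= 1]. Levels from [s0] on are first reached after both [N0] and
   [N1], so this and the hypothesis on [mu] are available at [m = a s]. *)
pose N1 := (Num.truncn (expR (expR 1) : R)).+1.
pose s0 := (r (maxn N0 N1)).+1.
have a_ge s : (s0 <= s)%N -> (maxn N0 N1 < a s)%N.
  rewrite /a; case: ex_minnP => m /andP[m1 sm] _ s0s; rewrite ltnNge; apply/negP => mN.
  have := r_nondecreasing m1 mN; have := leq_trans s0s sm.
  by rewrite /s0 => h1 h2; have := leq_trans h1 h2; rewrite ltnn.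
have mu_le s : (s0 <= s)%N -> (mu (miss s (a s).-1) <=
    (expR (- (D / 2 * ln (ln 2))) * expR (- (D / 2 * ln s%:R)))%:E)%E.
  move=> s0s; have := a_ge _ s0s; set m := a s => Nm.
  have [m1 sm] : (1 <= m)%N /\ (s <= r m)%N.
    by rewrite /m /a; case: ex_minnP => ? /andP[].
  have s1 : (0 < s)%N by apply: leq_trans s0s.
  rewrite mu_miss lee_fin; apply: le_trans (no_run_prob_le_expR _ s1) _.
  rewrite prednK//; apply: rare_miss_bound => //.
    have N1m : expR (expR 1) <= m%:R :> R.
      apply: le_trans (ltW (truncnS_gt _)) _; rewrite ler_nat -/N1.
      by apply: leq_trans (ltnW Nm); rewrite leq_maxr.
    have l1 : expR 1 <= ln m%:R :> R.
      by rewrite -[leLHS]expRK ler_ln ?posrE ?expR_gt0 ?ltr0n.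
    by rewrite -[leLHS]expRK ler_ln ?posrE ?expR_gt0 ?(lt_le_trans _ l1) ?expR_gt0.
  have /hN0 : (N0 <= m)%N by apply: leq_trans (ltnW Nm); rewrite leq_maxl.
  rewrite /B mu_zero_cylinder lee_fin => /le_trans; apply.
  by apply: ler_wiXn2l; [lra|lra|].
pose F n := miss (n + s0).+1 (a (n + s0).+1).-1.
pose d := D / 2 - 1.
have d0 : 0 < d by rewrite /d; lra.
pose C := expR (- (D / 2 * ln (ln 2))) / d.
have C0 : 0 <= C by rewrite divr_ge0 ?expR_ge0// ltW.
have sumF : (\sum_(n <oo) mu (F n) < +oo)%E.
  pose g n := C * expR (- (d * ln (n + s0)%:R)).
  apply: (@nneseries_telescope_fin _ _ g) => [n|n|n] //.
    by rewrite mulr_ge0 ?expR_ge0.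
  apply: (le_trans (mu_le (n + s0).+1 _)); first by rewrite leqW// leq_addl.
  rewrite lee_fin /g -mulrBr addSn.
  have ns0 : (0 < n + s0)%N by rewrite addn_gt0 orbT.
  have h := power_telescope d0 ns0.
  apply: le_trans (ler_wpM2l C0 h).
  rewrite /C mulrA divfK ?gt_eqF//.
  by rewrite (_ : 1 + d = D / 2)//; rewrite /d; ring.
have mF n : measurable (F n) by exact: measurable_miss.
have lim0 := lim_sup_set_cvg0 mF sumF.
(* If [B m] is missed, then [a (r m) <= m] by minimality, so [x] lies in the event of level [r m].
   Such [m] are arbitrarily large and [r] is unbounded, so infinitely many levels occur. *)
have sub : ~` eventually_always_hitting B `<=` lim_sup_set F.
  move=> x nx n _.
  have [m1 [m1_gt0 nm1]] := r_unbounded (n + s0).+1.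
  have [m mm1 nhit] : exists2 m, (m1 <= m)%N & ~ (forward_orbit m x `&` B m !=set0).
    apply: contrapT => H; apply: nx; exists m1 => // m /= mm1.
    by apply: contrapT => nhit; apply: H; exists m.
  have m0 : (0 < m)%N by exact: leq_trans mm1.
  have rm : (n + s0 < r m)%N by apply: leq_trans nm1 (r_nondecreasing _ _).
  exists (r m - s0.+1)%N; first by rewrite /=; lia.
  rewrite /F (_ : (r m - s0.+1 + s0).+1 = r m); last lia.
  apply: miss_anti (miss_of_no_hit m0 nhit).
  rewrite /a; case: ex_minnP => k _ kmin.
  have : (k <= m)%N by apply: kmin; rewrite m0 leqnn.
  by case: k {kmin} => //= k; case: m {nhit mm1 m0 rm}.
have : mu (~` eventually_always_hitting B) = 0%E.
  apply/eqP; rewrite eq_le measure_ge0 andbT -lim0; apply: le_measure => //; rewrite inE.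
    exact: measurableC.
  apply: bigcapT_measurable => n; apply: bigcup_measurable => k _; exact: mF.
rewrite probability_setC// => h.
have : mu (eventually_always_hitting B) \is a fin_num by exact: fin_num_measure.
move: h; case: (mu _) => //= p; rewrite -EFinB => -[] h _.
by congr EFin; lra.
Qed.

Let always_hitting N := [set x | forall m, (N <= m)%N -> forward_orbit m x `&` B m !=set0].

Let measurable_always_hitting N : measurable (always_hitting N).
Proof.
rewrite (_ : always_hitting N = \bigcap_(m in [set m | N <= m]%N)
   \bigcup_(k in [set k | 1 <= k <= m]%N) [set x : binseq | B m (iter k Defs.shift x)]).
  apply: bigcap_measurableType => m _; apply: bigcup_measurable => k _.
  apply: measurable_shift_iter; exact: measurable_zero_cylinder.
apply/seteqP; split => x /= H m /=.
  by move=> /H[_ [[k km <-] Bk]]; exists k.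
by move=> /H[k km Bk]; exists (iter k Defs.shift x); split => //; exists k.
Qed.

Lemma zero_measure :
  (\forall m \near \oo, (mu (B m) <= (2 * ln (ln m%:R) / m%:R)%:E)%E) ->
  mu (eventually_always_hitting B) = 0%E.
Proof.
move=> [N0 _ hN0].
have bound N b : (maxn 7 (maxn N N0) <= b)%N ->
    (mu (always_hitting N) <= (56 * expR 1 / 2 ^+ b)%:E)%E.
  rewrite !geq_max => /and3P[b7 Nb N0b].
  have [u [K [s [u0 s_homo hs hp]]]] := @block_of_scales R b b7.
  set M := fun j => _ in hp.
  apply: (@le_trans _ _ ((word_prob R (all_runs s M K) (M K))%:E)); last by rewrite lee_fin.
  rewrite -(mu_word mu_bernoulli); apply: le_measure; rewrite ?inE//.
    exact: measurable_word mu_bernoulli (all_runs s M K) (M K).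
  move=> x hx /=; apply/allP => j; rewrite mem_iota add0n => /= jK.
  have [bs lu] := hs _ jK.
  (* A run of [s j.+1] zeros starting at or before [m] ends before [m + s j.+1 = M j.+1], inside the
     prefix that [all_runs] inspects. *)
  pose m := (2 ^ s j.+1 * u)%N.
  have bm : (b <= m)%N.
    apply: leq_trans bs _; apply: leq_trans (ltnW (ltn_expl _ (ltnSn 1))) _.
    by rewrite leq_pmulr.
  have sr : (s j.+1 <= r m)%N.
    apply: (@level_at_scale R _ u) => //.
    by rewrite -lee_fin -mu_zero_cylinder; apply: hN0; exact: leq_trans N0b bm.
  have := orbit_hits_zero_run sr (hx m (leq_trans Nb bm)).
  have -> // : take (M j.+1) (mkseq x (M K)) = mkseq x (m + s j.+1).
  rewrite /mkseq -map_take take_iota; congr map; congr iota; apply/minn_idPl.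
  by rewrite /M leq_add ?s_homo// leq_mul2r leq_pexp2l ?s_homo// orbT.
have null N : mu (always_hitting N) = 0%E.
  apply/eqP; rewrite eq_le measure_ge0 andbT; apply/lee_addgt0Pr => e e0.
  rewrite add0e; pose c : R := 56 * expR 1.
  have c0 : 0 < c by rewrite mulr_gt0 ?expR_gt0.
  (* With [N] fixed, [b] is free to grow, and [2 ^ b > b > c / e]. *)
  pose b := (maxn (maxn 7 (maxn N N0)) (Num.truncn (c / e)).+1).
  apply: le_trans (bound N b (leq_maxl _ _)) _; rewrite lee_fin.
  rewrite ler_pdivrMr ?exprn_gt0// [leRHS]mulrC -ler_pdivrMr// -/c.
  apply: le_trans (ltW (truncnS_gt _)) _; rewrite -natrX ler_nat.
  by apply: leq_trans (ltnW (ltn_expl _ (ltnSn 1))); exact: leq_maxr.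
have -> : eventually_always_hitting B = \bigcup_N always_hitting N.
  apply/seteqP; split => x.
    by move=> [N _ H]; exists N => // m; exact: H.
  by move=> [N _ H]; exists N => // m; exact: H.
apply/negligibleP; first by apply: bigcup_measurable => N _; exact: measurable_always_hitting.
apply: negligible_bigcup => N; apply/negligibleP; last exact: null.
exact: measurable_always_hitting.
Qed.

End main.

Theorem corollary1p5 (R : realType) (mu : probability binseq R)
  (mu_bernoulli : fair_bernoulli mu)
  (r : nat -> nat)
  (r_gt0 : forall m, (1 <= m)%N -> (0 < r m)%N)
  (r_nondecreasing : forall m n, (1 <= m)%N -> (m <= n)%N -> (r m <= r n)%N)
  (r_unbounded : forall M, exists m, (1 <= m)%N /\ (M <= r m)%N) :
  let B := fun m : nat => zero_cylinder (r m) in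
  ((exists D : R, 2 < D /\
      \forall m \near \oo, ((D * ln (ln m%:R) / m%:R)%:E <= mu (B m))%E) ->
    mu (eventually_always_hitting B) = 1%E)
  /\
  ((\forall m \near \oo, (mu (B m) <= (2 * ln (ln m%:R) / m%:R)%:E)%E) ->
    mu (eventually_always_hitting B) = 0%E).
Proof.
move=> B; split => [[D [D2 hD]]|h].
  exact: full_measure D2 hD.
exact: zero_measure h.
Qed.
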